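(* Let $r \ge 1$ be odd, $a \ge 1$ be odd, $s\ge 0$ an integer, and let $t \ge 2$, or $t=1$ and $a < rt+s$. Then $$r \left\lceil \frac{tr+s}{a}\right\rceil + (t-1)r+1 \le \sigma(r,s,a,t) \le r \left\lceil\frac{tr+s+1}{a}\right\rceil + (t-1)r+1.$$ Moreover, if $d \ge r \left\lceil\frac{rt+s}{a}\right\rceil +(t-1)r+1$ then there are at least $t$ integer values of $x$ satisfying $\frac{d+s}{r+a} \le x < \frac{d}{r}$.
   Context: All graphs are finite simple graphs. A $(d,d+s)$-graph is a graph all of whose vertex degrees lie in $\{d, \ldots, d+s\}$. An $(r,r+a)$-factor of $G$ is a spanning subgraph all of whose degrees lie in $\{r,\ldots,r+a\}$; an $(r,r+a)$-factorization of $G$ with $x$ factors is a decomposition of $E(G)$ into $x$ edge-disjoint $(r,r+a)$-factors. $\sigma(r,s,a,t)$ is the least integer such that, whenever $d \ge \sigma(r,s,a,t)$, every simple $(d,d+s)$-graph has an $(r,r+a)$-factorization with $x$ factors for at least $t$ different values of $x$. *)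

(* Defs.v *)
(* MathComp *)
From mathcomp Require Import all_boot all_order all_algebra.
Set Implicit Arguments.
Unset Strict Implicit.
Unset Printing Implicit Defensive.
Import Order.TTheory GRing.Theory Num.Theory.

Definition degree (T : finType) (e : rel T) (v : T) : nat := #|[set w | e v w]|.

Definition simple_graph (T : finType) (e : rel T) : Prop :=
  symmetric e /\ irreflexive e.

Definition degrees_between (T : finType) (m n : nat) (e : rel T) : Prop :=
  forall v, m <= degree e v <= n.

(* Spanning subgraphs are given by edge relations on the same vertex type;
   irreflexivity of f is inherited from e. *)
Definition is_factor (r a : nat) (T : finType) (e f : rel T) : Prop :=
  [/\ symmetric f, subrel f e & degrees_between r (r + a) f].

Definition has_factorization (r a x : nat) (T : finType) (e : rel T) : Prop :=
  exists F : 'I_x -> rel T,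
    [/\ forall i, is_factor r a e (F i),
        forall i j u v, F i u v -> F j u v -> i = j
      & forall u v, e u v -> exists i, F i u v].

Definition at_least (X : eqType) (t : nat) (P : X -> Prop) : Prop :=
  exists xs : seq X, [/\ uniq xs, t <= size xs & forall x, x \in xs -> P x].

Definition sigma_property (r s a t : nat) (N : int) : Prop :=
  forall d : nat, (N <= d%:Z)%R ->
  forall (T : finType) (e : rel T),
    simple_graph e -> degrees_between d (d + s) e ->
    at_least t (fun x : nat => has_factorization r a x e).

(* The least integer with sigma_property, as a relation: such an integer need
   not exist for arbitrary parameters. *)
Definition is_sigma (r s a t : nat) (N : int) : Prop :=
  sigma_property r s a t N /\
  forall M : int, sigma_property r s a t M -> (N <= M)%R.

(* Main.v *)
(* Upper bound: if x r < deg v < x (r + a) for every vertex v, then G splits into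
   x factors.  One colours E(G) with x colours so that at every vertex the colour
   degrees differ by at most one (Hilton and de Werra).  Such a colouring exists
   as soon as no degree of a non-isolated vertex is divisible by x, and pendant
   edges reduce the general case to this one.  To find it, minimise the sum of
   the squares of all colour degrees.  At a minimum, a vertex v with
   deg_a v >= deg_b v + 2 is the end of a closed alternating (a, b)-trail of odd
   length all of whose other vertices are balanced in a and b.  Starting from an
   edge of colour a at v one builds a Vizing fan v w_0, v w_1, ..., each w_i
   proposing a colour whose degree at w_i differs from that of the colours used
   so far; the fan never closes up, which is absurd since there are only x
   colours.

   Lower bound: for d = k r with k = ceil ((t r + s) / a) + t - 1, the
   value x = k is excluded by a d-regular component with an odd vertex set W left
   by at most one edge: some r-factor would be r-regular on W, with r odd. *)
Require Import Defs.
From mathcomp Require Import all_boot all_order all_algebra.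
From mathcomp Require Import perm zify.
From Stdlib Require Import Classical.
Import Order.TTheory GRing.Theory Num.Theory.
Set Implicit Arguments.
Unset Strict Implicit.
Unset Printing Implicit Defensive.

(** * Optimal edge colourings *)

Lemma eq_set2 (T : finType) (u w x y : T) :
  ([set u; w] == [set x; y]) = (u == x) && (w == y) || (u == y) && (w == x).
Proof.
apply/eqP/idP => [E|]; last first.
  by case/orP=> /andP[/eqP-> /eqP->] //; rewrite setUC.
have := congr1 (fun A : {set T} => u \in A) E; have := congr1 (fun A : {set T} => w \in A) E.
have := congr1 (fun A : {set T} => x \in A) E; have := congr1 (fun A : {set T} => y \in A) E.
rewrite !inE !eqxx ?orbT /= ![_ == u]eq_sym ![_ == w]eq_sym.
by do 4 case: eqP => //= ?; subst.
Qed.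

Section EdgeColoring.
Variables (T : finType) (e : rel T) (C : finType).
Hypotheses (sym_e : symmetric e) (irr_e : irreflexive e).
Implicit Types (phi psi : T -> T -> C) (a b c d : C) (u v w x y z : T).

(** A colouring is a total function on ordered pairs of vertices; only its values on edges of [e]
    enter the count. *)
Definition cdeg phi v c := #|[set w | e v w && (phi v w == c)]|.

Definition energy_at phi v := \sum_c cdeg phi v c ^ 2.

Definition energy phi := \sum_v energy_at phi v.

Definition symcol phi := forall x y, phi x y = phi y x.

Definition optimal phi :=
  symcol phi /\ forall psi, symcol psi -> energy phi <= energy psi.

Lemma e_neq x y : e x y -> x != y.
Proof. by apply: contraTneq => ->; rewrite irr_e. Qed.

Lemma eq_cdeg phi psi v c :
  (forall w, phi v w = psi v w) -> cdeg phi v c = cdeg psi v c.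
Proof. by move=> E; apply: eq_card => w; rewrite !inE E. Qed.

Definition recolor phi x y c : T -> T -> C :=
  fun u w => if [set u; w] == [set x; y] then c else phi u w.

Lemma recolor_sym phi x y c : symcol phi -> symcol (recolor phi x y c).
Proof. by move=> S u w; rewrite /recolor setUC S. Qed.

(** The additive form avoids truncated subtraction and also covers a recolouring with the old
    colour. *)
Lemma cdeg_recolor phi x y c u d : symcol phi -> e x y ->
  cdeg (recolor phi x y c) u d + ((u == x) + (u == y)) * (phi x y == d) =
  cdeg phi u d + ((u == x) + (u == y)) * (c == d).
Proof.
move=> S exy; have nxy := e_neq exy.
have main x' y' : e x' y' -> [set x'; y'] = [set x; y] ->
    cdeg (recolor phi x y c) x' d + (phi x' y' == d) = cdeg phi x' d + (c == d).
  move=> exy' E; rewrite /cdeg (cardsD1 y') [in RHS](cardsD1 y') !inE exy' /=.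
  rewrite {1}/recolor E eqxx addnAC [in RHS]addnAC [(c == d) + _]addnC.
  congr (_ + _); apply: eq_card => w; rewrite !inE /recolor -E eq_set2 eqxx /=.
  by case: (w == y') => //=; case: (x' =P y') (e_neq exy').
case: (u =P x) => [->|/eqP nux]; first by rewrite (negPf nxy) addn0 !mul1n main.
case: (u =P y) => [->|/eqP nuy].
  by rewrite add0n !mul1n S main ?[e y x]sym_e // setUC.
rewrite !mul0n !addn0; apply: eq_cdeg => w.
by rewrite /recolor eq_set2 (negPf nux) (negPf nuy).
Qed.

(** * Alternating trails and colour swaps along them *)

Definition edges x (s : seq T) := pairmap (fun u w => [set u; w]) x s.

Fixpoint alternating phi a b x s :=
  if s is y :: s' then [&& e x y, phi x y == a & alternating phi b a y s']
  else true.

(** Edges are unordered pairs, so no edge recurs in either direction, while vertices may recur. *)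
Definition trail phi a b x s := alternating phi a b x s && uniq (edges x s).

Definition swap phi a b (E : seq {set T}) : T -> T -> C :=
  fun u w => if [set u; w] \in E then tperm a b (phi u w) else phi u w.

Lemma swap_sym phi a b E : symcol phi -> symcol (swap phi a b E).
Proof. by move=> S u w; rewrite /swap setUC S. Qed.

Lemma eq_alternating phi psi a b x s :
  (forall u w, [set u; w] \in edges x s -> phi u w = psi u w) ->
  alternating phi a b x s = alternating psi a b x s.
Proof.
elim: s x a b => //= y s IH x a b E; rewrite E ?mem_head //.
by rewrite IH // => u w uw; rewrite E // inE uw orbT.
Qed.

(** Lets a swap proceed edge by edge: the first edge does not recur, so it can be recoloured before
    the rest is swapped. *)
Lemma swap_cons phi a b x y s u w : symcol phi -> trail phi a b x (y :: s) ->
  swap phi a b (edges x (y :: s)) u w =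
  swap (recolor phi x y b) b a (edges y s) u w.
Proof.
move=> S /andP[/= /and3P[exy /eqP pxy _] /andP[nin _]].
rewrite /swap /recolor inE [tperm b a]tpermC.
case: eqP => [E|_] //=; rewrite -E in nin; rewrite (negPf nin).
suff -> : phi u w = a by rewrite tpermL.
by move/eqP: E; rewrite eq_set2 => /orP[] /andP[/eqP-> /eqP->] //; rewrite S.
Qed.

Lemma trail_cons phi a b x y s : trail phi a b x (y :: s) ->
  trail (recolor phi x y b) b a y s.
Proof.
move=> /andP[/= /and3P[exy /eqP pxy al] /andP[nin un]]; rewrite /trail un andbT.
rewrite (@eq_alternating _ phi) // => u w uw.
by rewrite /recolor; case: eqP => // E; rewrite -E uw in nin.
Qed.

(** Each inner passage uses one edge of either colour, so only the two ends change; the last edge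
    has colour [a] exactly when the length is odd. *)
Lemma cdeg_swap phi a b x s u : a != b -> symcol phi -> trail phi a b x s ->
  [/\ cdeg (swap phi a b (edges x s)) u a + (u == x) + odd (size s) * (u == last x s)
        = cdeg phi u a + ~~ odd (size s) * (u == last x s),
      cdeg (swap phi a b (edges x s)) u b + ~~ odd (size s) * (u == last x s)
        = cdeg phi u b + (u == x) + odd (size s) * (u == last x s)
    & forall d, d != a -> d != b ->
        cdeg (swap phi a b (edges x s)) u d = cdeg phi u d].
Proof.
elim: s x a b phi => [|y s IH] x a b phi nab S tr.
  have E c : cdeg (swap phi a b (edges x [::])) u c = cdeg phi u c.
    by apply: eq_cdeg.
  by rewrite !E /= !mul1n !mul0n !addn0.
have E c : cdeg (swap phi a b (edges x (y :: s))) u c =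
    cdeg (swap (recolor phi x y b) b a (edges y s)) u c.
  by apply: eq_cdeg => w; apply: swap_cons.
rewrite !E.
have := IH y b a _ _ (recolor_sym _ _ _ S) (trail_cons tr).
rewrite eq_sym => /(_ nab).
move: tr => /andP[/= /and3P[exy /eqP pxy _] _] [h1 h2 h3].
have R d := cdeg_recolor b u d S exy.
have Ra := R a; have Rb := R b.
rewrite pxy eqxx [b == a]eq_sym (negPf nab) in Ra Rb; rewrite eqxx in Rb.
split.
- move: h2 Ra; rewrite /=; case: (odd (size s)) => /=; lia.
- move: h1 Rb; rewrite /=; case: (odd (size s)) => /=; lia.
move=> d nda ndb; rewrite E h3 //.
have := R d; rewrite pxy [a == d]eq_sym [b == d]eq_sym (negPf nda) (negPf ndb).
by rewrite !muln0 !addn0.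
Qed.

Lemma sum_cdeg phi v : \sum_c cdeg phi v c = degree e v.
Proof.
rewrite /cdeg /degree -sum1_card (partition_big (phi v) xpredT) //=.
by apply: eq_bigr => c _; rewrite -sum1_card; apply: eq_bigl => w; rewrite !inE.
Qed.

(** * Energy under local changes of the colouring *)

Lemma energy_at_eq phi psi v :
  (forall d, cdeg psi v d = cdeg phi v d) -> energy_at psi v = energy_at phi v.
Proof. by move=> E; apply: eq_bigr => c _; rewrite E. Qed.

Lemma energy_at_change phi psi v a b : a != b ->
  (forall d, d != a -> d != b -> cdeg psi v d = cdeg phi v d) ->
  energy_at psi v + cdeg phi v a ^ 2 + cdeg phi v b ^ 2 =
  energy_at phi v + cdeg psi v a ^ 2 + cdeg psi v b ^ 2.
Proof.
move=> nab E; rewrite /energy_at.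
rewrite (bigD1 a) //= (bigD1 b) 1?eq_sym //= [in RHS](bigD1 a) //=.
rewrite [in RHS](bigD1 b) 1?eq_sym //=.
rewrite (eq_bigr (fun c => cdeg phi v c ^ 2)); first by lia.
by move=> c /andP[ca cb]; rewrite E.
Qed.

Lemma energy_at_move phi psi v a b n : a != b ->
  (forall d, d != a -> d != b -> cdeg psi v d = cdeg phi v d) ->
  cdeg psi v a + n = cdeg phi v a -> cdeg psi v b = cdeg phi v b + n ->
  energy_at psi v + 2 * n * cdeg phi v a =
  energy_at phi v + 2 * n * cdeg phi v b + 2 * n ^ 2.
Proof.
move=> nab E Ea Eb; have := energy_at_change nab E.
rewrite Eb -Ea -!mulnn; nia.
Qed.

Lemma energy_eq1 phi psi x :
  (forall u, u != x -> energy_at psi u = energy_at phi u) ->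
  energy psi + energy_at phi x = energy phi + energy_at psi x.
Proof.
move=> E; rewrite /energy (bigD1 x) //= [in RHS](bigD1 x) //=.
rewrite (eq_bigr (energy_at phi)) => [|u ux]; [by lia | exact: E].
Qed.

Lemma energy_eq2 phi psi x z : x != z ->
  (forall u, u != x -> u != z -> energy_at psi u = energy_at phi u) ->
  energy psi + energy_at phi x + energy_at phi z =
  energy phi + energy_at psi x + energy_at psi z.
Proof.
move=> nxz E; rewrite /energy (bigD1 x) //= (bigD1 z) 1?eq_sym //=.
rewrite [in RHS](bigD1 x) //= [in RHS](bigD1 z) 1?eq_sym //=.
rewrite (eq_bigr (energy_at phi)) => [|u /andP[ux uz]]; [by lia | exact: E].
Qed.

Lemma optimal_le phi psi :
  optimal phi -> symcol psi -> energy psi <= energy phi -> optimal psi.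
Proof. by move=> [_ m] S le; split=> // chi /m; apply: leq_trans. Qed.

Lemma optimal_exists phi : symcol phi -> exists psi, optimal psi.
Proof.
move=> S; have [n] := ubnP (energy phi); elim: n phi S => // n IH phi S le.
case: (classic (exists2 psi, symcol psi & energy psi < energy phi)).
  by case=> psi Spsi lt; apply: (IH psi) => //; apply: leq_trans lt _.
move=> m; exists phi; split=> // psi Spsi; rewrite leqNgt.
by apply/negP => lt; case: m; exists psi.
Qed.

Lemma edges_rcons x s y : edges x (rcons s y) = rcons (edges x s) [set last x s; y].
Proof. by rewrite /edges -cats1 pairmap_cat cats1. Qed.

Lemma alternating_rcons phi a b x s y :
  alternating phi a b x (rcons s y) =
  [&& alternating phi a b x s, e (last x s) y &
      phi (last x s) y == if odd (size s) then b else a].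
Proof.
elim: s x a b => [|z s IH] x a b /=; first by rewrite andbT.
by rewrite IH !andbA; case: (odd (size s)).
Qed.

Lemma trail_prefix phi a b x s1 s2 : trail phi a b x (s1 ++ s2) -> trail phi a b x s1.
Proof.
elim/last_ind: s2 => [|s2 y IH]; rewrite ?cats0 // -rcons_cat.
rewrite /trail alternating_rcons edges_rcons rcons_uniq => /andP[/and3P[al _ _]].
by move=> /andP[_ un]; apply: IH; rewrite /trail al.
Qed.

Lemma trail_size phi a b x s : trail phi a b x s -> size s <= #|{set T}|.
Proof.
move=> /andP[_ /card_uniqP]; rewrite size_pairmap => <-; exact: max_card.
Qed.

(** Trails have bounded length, so greedy extension by one edge stops. *)
Lemma maximal_trail phi a b x : exists2 s, trail phi a b x s &
  forall y, e (last x s) y -> phi (last x s) y = (if odd (size s) then b else a) ->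
    [set last x s; y] \in edges x s.
Proof.
suff [s tr mx] : exists2 s, trail phi a b x s & forall y, ~~ trail phi a b x (rcons s y).
  exists s => // y exy pxy; apply: contraT => nin; case/negP: (mx y).
  case/andP: tr => al un.
  by rewrite /trail alternating_rcons edges_rcons rcons_uniq al un exy pxy eqxx nin.
suff H n s : #|{set T}| < size s + n -> trail phi a b x s ->
    exists2 s, trail phi a b x s & forall y, ~~ trail phi a b x (rcons s y).
  by apply: (H #|{set T}|.+1 [::]).
elim: n s => [|n IH] s le tr.
  by have := trail_size tr; rewrite leqNgt -[size s]addn0 le.
case: (boolP [exists y, trail phi a b x (rcons s y)]) => [/existsP[y]|].
  by apply: IH; rewrite size_rcons addSnnS.
by rewrite negb_exists => /forallP mx; exists s.
Qed.

Lemma alternating_swap phi a b x s E :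
  {subset edges x s <= E} ->
  alternating (swap phi a b E) b a x s = alternating phi a b x s.
Proof.
move=> sub0.
(* The colours alternate along the trail, so the induction needs an arbitrary pair exchanged by the
   transposition. *)
suff H c d : tperm a b c = d -> tperm a b d = c -> {subset edges x s <= E} ->
   alternating (swap phi a b E) d c x s = alternating phi c d x s.
  by apply: H; rewrite ?tpermL ?tpermR.
elim: s x {sub0} c d => //= y s IH x c d cd dc sub.
rewrite {1}/swap sub ?mem_head // -{1}cd (inj_eq perm_inj).
by rewrite IH // => A sA; rewrite sub // inE sA orbT.
Qed.

Lemma trail_swap phi a b x s E : {subset edges x s <= E} ->
  trail phi a b x s -> trail (swap phi a b E) b a x s.
Proof. by move=> sub; rewrite /trail alternating_swap. Qed.

(** Only the two distinct ends contribute, each by [energy_at_move] with [n = 1]; the parity decides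
    which colour the far end loses. *)
Lemma trail_energy phi a b x s : a != b -> symcol phi -> trail phi a b x s ->
  x != last x s ->
  if odd (size s) then
    energy (swap phi a b (edges x s)) + 2 * cdeg phi x a + 2 * cdeg phi (last x s) a =
    energy phi + 2 * cdeg phi x b + 2 * cdeg phi (last x s) b + 4
  else
    energy (swap phi a b (edges x s)) + 2 * cdeg phi x a + 2 * cdeg phi (last x s) b =
    energy phi + 2 * cdeg phi x b + 2 * cdeg phi (last x s) a + 4.
Proof.
move=> nab S tr; set z := last x s => nxz; set psi := swap _ _ _ _.
have H u := cdeg_swap u nab S tr; rewrite -/psi -/z in H.
have En : energy psi + energy_at phi x + energy_at phi z =
    energy phi + energy_at psi x + energy_at psi z.
  apply: energy_eq2 => // u ux uz; apply: energy_at_eq => d.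
  have [Ha Hb Hd] := H u.
  rewrite (negPf ux) (negPf uz) !muln0 !addn0 in Ha Hb.
  by case: (d =P a) => [->|/eqP da] //; case: (d =P b) => [->|/eqP db] //; apply: Hd.
have [Ha Hb Hd] := H x; have [Ka Kb Kd] := H z.
rewrite eqxx (negPf nxz) !muln0 !addn0 in Ha Hb.
rewrite eqxx [z == x]eq_sym (negPf nxz) !muln1 !addn0 in Ka Kb.
have Ex := energy_at_move nab Hd Ha Hb.
case: ifP => od; rewrite od /= !addn0 in Ka Kb.
  have Ez := energy_at_move nab Kd Ka Kb; lia.
have nba : b != a by rewrite eq_sym.
have Ez := energy_at_move nba (fun d h1 h2 => Kd d h2 h1) Kb Ka; lia.
Qed.

(** * Closed trails at an unbalanced vertex *)

Lemma swap_closed phi a b v s : a != b -> symcol phi -> trail phi a b v s ->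
  last v s = v -> odd (size s) ->
  let psi := swap phi a b (edges v s) in
  [/\ cdeg psi v a + 2 = cdeg phi v a, cdeg psi v b = cdeg phi v b + 2,
      forall d, d != a -> d != b -> cdeg psi v d = cdeg phi v d,
      forall u d, u != v -> cdeg psi u d = cdeg phi u d
    & energy psi + 4 * cdeg phi v a = energy phi + 4 * cdeg phi v b + 8].
Proof.
move=> nab S tr lst od psi.
have H u := cdeg_swap u nab S tr; rewrite -/psi lst od /= in H.
have off u d : u != v -> cdeg psi u d = cdeg phi u d.
  move=> uv; have [Ha Hb Hd] := H u.
  rewrite (negPf uv) !muln0 !addn0 in Ha Hb.
  by case: (d =P a) => [->|/eqP da] //; case: (d =P b) => [->|/eqP db] //; apply: Hd.
have [] := H v; rewrite eqxx !muln1 !addn0 -!addnA => Ha Hb Hd.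
split=> //.
have En : energy psi + energy_at phi v = energy phi + energy_at psi v.
  by apply: energy_eq1 => u uv; apply: energy_at_eq => d; apply: off.
have := energy_at_move nab Hd Ha Hb; lia.
Qed.

(** A maximal trail from [v] is swapped. If it ended elsewhere, the energy would drop; if it closed
    with even length, maximality would give [v] at least as many edges of colour [b] as of colour
    [a]. An odd closed trail lowers the energy unless the gap is exactly 2. *)
Lemma kempe phi a b v : a != b -> optimal phi -> cdeg phi v b + 2 <= cdeg phi v a ->
  exists s, [/\ trail phi a b v s, last v s = v, odd (size s),
    cdeg phi v a = cdeg phi v b + 2
  & forall w, e v w -> (phi v w == a) || (phi v w == b) -> [set v; w] \in edges v s].
Proof.
move=> nab [S opt] le; have [s tr mx] := maximal_trail phi a b v.
have nba : b != a by rewrite eq_sym.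
set psi := swap phi a b (edges v s).
have Spsi : symcol psi by apply: swap_sym.
have optpsi := opt _ Spsi.
(* By maximality all edges of the next colour at the last vertex lie on the trail, so each of them
   changes colour. *)
have dz : if odd (size s) then cdeg phi (last v s) b <= cdeg psi (last v s) a
          else cdeg phi (last v s) a <= cdeg psi (last v s) b.
  case: ifP mx => _ mx; apply/subset_leq_card/subsetP => w; rewrite !inE.
    by case/andP=> ew /eqP pw; rewrite ew /psi /swap mx // pw tpermR eqxx.
  by case/andP=> ew /eqP pw; rewrite ew /psi /swap mx // pw tpermL eqxx.
have [Ha Hb _] := cdeg_swap (last v s) nab S tr.
rewrite -/psi eqxx !muln1 in Ha Hb.
case: (boolP (v == last v s)) => [/eqP lst|nvl]; last first.
  have := trail_energy nab S tr nvl; rewrite -/psi.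
  rewrite [last v s == v]eq_sym (negPf nvl) !addn0 in Ha Hb.
  by case: (odd (size s)) dz Ha Hb => /= dz Ha Hb E; lia.
rewrite -lst eqxx in Ha Hb dz.
case: (boolP (odd (size s))) => od; rewrite ?od ?(negPf od) /= in Ha Hb dz mx; last lia.
have [Ka Kb _ _ En] := swap_closed nab S tr (esym lst) od.
rewrite -/psi in Ka Kb En.
have E2 : cdeg phi v a = cdeg phi v b + 2 by lia.
exists s; split=> // w ew /orP[] /eqP pw; last by rewrite -lst in mx; apply: mx.
(* After the swap every [b]-edge at [v] was an [a]-edge before. Both sets have the same size, so all
   [a]-edges at [v] were swapped. *)
have sub : [set w | e v w && (psi v w == b)] \subset [set w | e v w && (phi v w == a)].
  apply/subsetP => u; rewrite !inE /psi /swap => /andP[eu].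
  case: ifP => uin; rewrite eu /=.
    by move/eqP=> pu; apply/eqP/(@perm_inj _ (tperm a b)); rewrite pu tpermL.
  by move/eqP=> pu; rewrite -lst in mx; rewrite mx in uin.
have /eqP eqs : [set w | e v w && (psi v w == b)] == [set w | e v w && (phi v w == a)].
  by rewrite eqEcard sub -[X in X <= _]/(cdeg phi v a) -[X in _ <= X]/(cdeg psi v b); lia.
have : w \in [set w | e v w && (psi v w == b)] by rewrite eqs inE ew pw eqxx.
rewrite inE ew /= /psi /swap; case: ifP => // _.
by rewrite pw (negPf nab).
Qed.

(** With a gap of exactly 2 the swap exchanges the two colour degrees at [v] and leaves the energy
    unchanged. *)
Lemma kempe_swap phi a b v s : a != b -> optimal phi -> trail phi a b v s ->
  last v s = v -> odd (size s) -> cdeg phi v a = cdeg phi v b + 2 ->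
  let psi := swap phi a b (edges v s) in
  [/\ optimal psi, cdeg psi v a = cdeg phi v b, cdeg psi v b = cdeg phi v a,
      forall d, d != a -> d != b -> cdeg psi v d = cdeg phi v d
    & forall u d, u != v -> cdeg psi u d = cdeg phi u d].
Proof.
move=> nab opt tr lst od E2 psi.
have [Ha Hb Hd off En] := swap_closed nab opt.1 tr lst od.
rewrite -/psi in Ha Hb Hd off En.
split=> //; try lia.
have le : energy psi <= energy phi by lia.
exact: optimal_le opt (swap_sym _ _ _ opt.1) le.
Qed.

(** When only the prefix is swapped, the gap 2 at [v] cancels the constant 4 in [trail_energy], so
    optimality leaves an inequality at [u]. *)
Lemma prefix_le phi a b v p u : a != b -> optimal phi -> trail phi a b v (rcons p u) ->
  u != v -> cdeg phi v a = cdeg phi v b + 2 ->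
  if odd (size (rcons p u)) then cdeg phi u a <= cdeg phi u b
  else cdeg phi u b <= cdeg phi u a.
Proof.
move=> nab [S opt] tr uv E2.
have := trail_energy nab S tr; rewrite last_rcons eq_sym => /(_ uv).
have := opt _ (swap_sym a b (edges v (rcons p u)) S).
by case: ifP => _; lia.
Qed.

(* The swapped colouring is optimal as well and traverses the trail with the
   colours exchanged, so each inequality holds in both directions. *)
Lemma kempe_balanced phi a b v s u : a != b -> optimal phi -> trail phi a b v s ->
  last v s = v -> odd (size s) -> cdeg phi v a = cdeg phi v b + 2 ->
  u \in s -> u != v -> cdeg phi u a = cdeg phi u b.
Proof.
move=> nab opt tr lst od E2 us uv.
have nba : b != a by rewrite eq_sym.
have [opt' Ka Kb _ off] := kempe_swap nab opt tr lst od E2.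
set psi := swap _ _ _ _ in opt' Ka Kb off.
have tr' : trail psi b a v s by apply: trail_swap.
case/splitPr: us tr tr' => p1 p2; rewrite -cat_rcons => tr tr'.
have := prefix_le nab opt (trail_prefix tr) uv E2.
have := prefix_le nba opt' (trail_prefix tr') uv.
rewrite Ka Kb => /(_ E2); rewrite !off //.
by case: ifP => _; lia.
Qed.

Lemma mem_edges x s A u : A \in edges x s -> u \in A -> u \in x :: s.
Proof.
elim: s x => //= y s IH x; rewrite inE => /orP[/eqP->|/IH H /H h].
  by rewrite !inE => /orP[] ->; rewrite ?orbT.
by rewrite inE h orbT.
Qed.

(** The edge [v w] lies on the closed trail from [v], so [w] is one of its balanced vertices. *)
Lemma kempe_neighbor phi a b v w : a != b -> optimal phi ->
  cdeg phi v b + 2 <= cdeg phi v a -> e v w -> (phi v w == a) || (phi v w == b) ->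
  cdeg phi v a = cdeg phi v b + 2 /\ cdeg phi w a = cdeg phi w b.
Proof.
move=> nab opt le ew pw; have [s [tr lst od E2 all_e]] := kempe nab opt le.
have nwv : w != v by rewrite eq_sym e_neq.
split=> //; apply: (kempe_balanced nab opt tr lst od E2) => //.
have := mem_edges (all_e w ew pw) (setU1r v (set11 w)).
by rewrite inE (negPf nwv).
Qed.

Lemma kempe_flip phi a b v : a != b -> optimal phi -> cdeg phi v a = cdeg phi v b + 2 ->
  exists psi, [/\ optimal psi,
    [/\ cdeg psi v a = cdeg phi v b, cdeg psi v b = cdeg phi v a
      & forall d, d != a -> d != b -> cdeg psi v d = cdeg phi v d],
    forall u d, u != v -> cdeg psi u d = cdeg phi u d,
    forall x y, phi x y != a -> phi x y != b -> psi x y = phi x y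
  & forall w, e v w -> phi v w = a -> psi v w = b].
Proof.
move=> nab opt E2.
have le : cdeg phi v b + 2 <= cdeg phi v a by rewrite E2.
have [s [tr lst od _ all_e]] := kempe nab opt le.
have [opt' Ka Kb Kd off] := kempe_swap nab opt tr lst od E2.
exists (swap phi a b (edges v s)); split=> // [x y xa xb|w ew pw].
  by rewrite /swap tpermD ?if_same // eq_sym.
by rewrite /swap all_e ?pw ?eqxx // tpermL.
Qed.

(** Were [c] as rare as [l] at [v], the pair [(h, c)] would have a gap of 2 and force balance at
    [w]. Were [c] at least 2 above [l], a flip of [(c, l)] at [v] would create that situation. *)
Lemma middle_color phi h l c v w : h != l -> optimal phi ->
  cdeg phi v h = cdeg phi v l + 2 -> e v w -> phi v w = h ->
  cdeg phi w c != cdeg phi w h -> cdeg phi v c = cdeg phi v l + 1.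
Proof.
move=> nhl opt E2 ew pw ne.
have nch : c != h by apply: contraNneq ne => ->.
have nhc : h != c by rewrite eq_sym.
have [_ whl] : cdeg phi v h = cdeg phi v l + 2 /\ cdeg phi w h = cdeg phi w l.
  by apply: kempe_neighbor; rewrite ?E2 ?pw ?eqxx.
have ncl : c != l by apply: contraNneq ne => ->; rewrite whl.
have lo : cdeg phi v l < cdeg phi v c.
  rewrite ltnNge; apply/negP => le.
  have le2 : cdeg phi v c + 2 <= cdeg phi v h by lia.
  have [_ wE] := kempe_neighbor nhc opt le2 ew (introT orP (or_introl (introT eqP pw))).
  by rewrite wE eqxx in ne.
have [//|lt] : cdeg phi v c = cdeg phi v l + 1 \/ cdeg phi v l + 2 <= cdeg phi v c.
  by lia.
have [s [_ _ _ E3 _]] := kempe ncl opt lt.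
have [psi [opt' [Pc Pl Pd] off keep _]] := kempe_flip ncl opt E3.
have nwv : w != v by rewrite eq_sym e_neq.
have le3 : cdeg psi v c + 2 <= cdeg psi v h by rewrite Pc Pd // E2.
have pw' : psi v w = h by rewrite keep pw.
have [_] := kempe_neighbor nhc opt' le3 ew (introT orP (or_introl (introT eqP pw'))).
by rewrite !off // => wE; rewrite wE eqxx in ne.
Qed.

(** * Moving the defect at a vertex to another colour pair *)

Lemma recolor_move phi x y a b : a != b -> symcol phi -> e x y -> phi x y = a ->
  let psi := recolor phi x y b in
  [/\ forall u, cdeg psi u a + ((u == x) + (u == y)) = cdeg phi u a,
      forall u, cdeg psi u b = cdeg phi u b + ((u == x) + (u == y)),
      forall u d, d != a -> d != b -> cdeg psi u d = cdeg phi u d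
    & energy psi + 2 * cdeg phi x a + 2 * cdeg phi y a =
      energy phi + 2 * cdeg phi x b + 2 * cdeg phi y b + 4].
Proof.
move=> nab S exy pxy psi.
have R u d : cdeg psi u d + _ = _ := cdeg_recolor b u d S exy.
have Ha u : cdeg psi u a + ((u == x) + (u == y)) = cdeg phi u a.
  by have := R u a; rewrite pxy eqxx [b == a]eq_sym (negPf nab) muln1 muln0 addn0.
have Hb u : cdeg psi u b = cdeg phi u b + ((u == x) + (u == y)).
  by have := R u b; rewrite pxy eqxx (negPf nab) muln1 muln0 addn0.
have Hd u d : d != a -> d != b -> cdeg psi u d = cdeg phi u d.
  move=> da db; have := R u d.
  by rewrite pxy [a == d]eq_sym [b == d]eq_sym (negPf da) (negPf db) muln0 !addn0.
split=> //; have nxy := e_neq exy.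
have En : energy psi + energy_at phi x + energy_at phi y =
    energy phi + energy_at psi x + energy_at psi y.
  apply: energy_eq2 => // u ux uy; apply: energy_at_eq => d.
  have [Ea Eb] := (Ha u, Hb u); rewrite (negPf ux) (negPf uy) !addn0 in Ea Eb.
  by case: (d =P a) => [->|/eqP da] //; case: (d =P b) => [->|/eqP db] //; apply: Hd.
have [Xa Xb] := (Ha x, Hb x); have [Ya Yb] := (Ha y, Hb y).
rewrite eqxx (negPf nxy) !addn0 in Xa Xb.
rewrite eqxx [y == x]eq_sym (negPf nxy) !add0n in Ya Yb.
have := energy_at_move nab (Hd x) Xa Xb; have := energy_at_move nab (Hd y) Ya Yb.
lia.
Qed.

Lemma recolor_other phi x y c u w : [set u; w] != [set x; y] ->
  recolor phi x y c u w = phi u w.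
Proof. by rewrite /recolor => /negPf->. Qed.

Lemma edges_split x s A : A \in edges x s ->
  exists p z q, s = p ++ z :: q /\ A = [set last x p; z].
Proof.
elim: s x => //= y s IH x; rewrite inE => /orP[/eqP->|/IH[p [z [q [-> ->]]]]].
  by exists [::], y, s.
by exists (y :: p), z, q.
Qed.

Lemma trail_mid phi a b x p z q : trail phi a b x (p ++ z :: q) ->
  [/\ trail phi a b x p, trail phi a b x (rcons p z),
      phi (last x p) z = (if odd (size p) then b else a)
    & [set last x p; z] \notin edges x p].
Proof.
rewrite -cat_rcons => /trail_prefix tr; split=> //.
- by move: tr; rewrite -cats1 => /trail_prefix.
- by case/andP: tr; rewrite alternating_rcons => /and3P[_ _ /eqP].
by case/andP: tr => _; rewrite edges_rcons rcons_uniq => /andP[].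
Qed.

(* A closed trail may be cut at its passage through the edge vy, on the side
   of v that makes the defect move from w to v without recolouring vy. *)
Lemma kempe_cut phi c h w s v y : c != h -> optimal phi -> trail phi c h w s ->
  last w s = w -> odd (size s) -> cdeg phi w c = cdeg phi w h + 2 ->
  cdeg phi v c = cdeg phi v h -> v != w -> phi v y = c -> [set v; y] \in edges w s ->
  exists psi, [/\ optimal psi,
    forall u, cdeg psi u c + (u == w) = cdeg phi u c + (u == v),
    forall u, cdeg psi u h + (u == v) = cdeg phi u h + (u == w),
    forall u d, d != c -> d != h -> cdeg psi u d = cdeg phi u d
  & psi v y = c /\ forall x z, phi x z != c -> phi x z != h -> psi x z = phi x z].
Proof.
move=> nch opt tr lst od Ew Ev nvw pvy vy_s; have S := opt.1.
have nhc : h != c by rewrite eq_sym.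
have [p [z [q [Es /eqP]]]] := edges_split vy_s.
rewrite eq_set2 => /orP[]/andP[/eqP Ez1 /eqP Ez2].
  move: tr; rewrite Es => /trail_mid[trp _ pc nin].
  (* Here the trail runs from [v] to [y]. The part before this edge is swapped; its length is even
     since the next colour is [c]. *)
  have odp : odd (size p) = false.
    apply/negbTE/negP => o; move: pc; rewrite o -Ez1 -Ez2 pvy => E.
    by rewrite E eqxx in nch.
  have := trail_energy nch S trp; have H u := cdeg_swap u nch S trp.
  rewrite odp -Ez1 eq_sym in H * => /(_ nvw) En.
  exists (swap phi c h (edges w p)); split.
  - by apply: optimal_le opt (swap_sym _ _ _ S) _; lia.
  - by move=> u; have [+ _ _] := H u; rewrite /= mul0n addn0 mul1n.
  - by move=> u; have [_ + _] := H u; rewrite /= mul0n addn0 mul1n.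
  - by move=> u d dc dh; have [_ _ ->] := H u.
  split=> [|x u xc xh]; last by rewrite /swap tpermD ?if_same // eq_sym.
  by rewrite -Ez1 -Ez2 in nin; rewrite /swap (negPf nin).
(* Here the trail runs from [y] to [v]. Swapping all of it and then swapping back the part through
   this edge amounts to swapping the rest, from [v] to [w]. *)
have [opt2 Kc Kh Kd off] := kempe_swap nch opt tr lst od Ew.
set phi2 := swap _ _ _ _ in opt2 Kc Kh Kd off.
have S2 := opt2.1.
have tr2 : trail phi2 h c w s by apply: trail_swap.
have pvy2 : phi2 v y = h by rewrite /phi2 /swap vy_s pvy tpermL.
move: tr2; rewrite Es => /trail_mid[_ trp pc _].
have odp : odd (size p) = false.
  apply/negbTE/negP => o; move: pc; rewrite o -Ez1 -Ez2 S2 pvy2 => E.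
  by rewrite E eqxx in nch.
have := trail_energy nhc S2 trp; have H u := cdeg_swap u nhc S2 trp.
rewrite last_rcons size_rcons /= odp /= -Ez1 eq_sym in H * => /(_ nvw).
rewrite Kc Kh !off // => En.
have vw0 : (v == w) = false by apply: negbTE.
exists (swap phi2 h c (edges w (rcons p z))); split.
- by apply: optimal_le opt2 (swap_sym _ _ _ S2) _; rewrite -Ez1; lia.
- move=> u; have [_ + _] := H u; rewrite -Ez1 mul0n addn0 mul1n => ->.
  case: (u =P w) => [->|/eqP uw]; last by rewrite off //=; lia.
  by rewrite Kc [w == v]eq_sym vw0; lia.
- move=> u; have [+ _ _] := H u; rewrite -Ez1 mul0n addn0 mul1n.
  case: (u =P w) => [->|/eqP uw]; last by rewrite off //=; lia.
  by rewrite Kh [w == v]eq_sym vw0; lia.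
- move=> u d dc dh; have [_ _ E] := H u; rewrite -Ez1 E //.
  by case: (u =P w) => [->|/eqP uw]; [rewrite Kd | rewrite off].
split=> [|x u xc xh].
  rewrite /swap edges_rcons mem_rcons inE -Ez1 -Ez2 [in [set y; v]]setUC.
  by rewrite eqxx pvy2 tpermL.
have -> : phi x u = phi2 x u by rewrite /phi2 /swap tpermD ?if_same // eq_sym.
have [uc uh] : phi2 x u != c /\ phi2 x u != h.
  by rewrite /phi2 /swap tpermD ?if_same // eq_sym.
by rewrite /swap tpermD ?if_same // eq_sym.
Qed.

(** By [middle_color] the degrees of [h], [c], [l] at [v] are consecutive. Recolouring [v w],
    possibly together with a swap from [w], exchanges the ranks of [h] and [c] without raising the
    energy. *)
Lemma rotate phi h l c v w y : h != l -> optimal phi ->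
  cdeg phi v h = cdeg phi v l + 2 -> e v w -> phi v w = h ->
  cdeg phi w c != cdeg phi w h -> e v y -> phi v y = c ->
  exists psi, [/\ optimal psi, cdeg psi v c = cdeg psi v l + 2 /\ psi v y = c,
    forall u d, u != v -> u != w -> cdeg psi u d = cdeg phi u d,
    forall d, d \notin [:: h; l; c] -> cdeg psi v d = cdeg phi v d
  & forall z, phi v z \notin [:: h; l; c] -> psi v z = phi v z].
Proof.
move=> nhl opt Ev ew pw ne ey py; have S := opt.1.
have Ec := middle_color nhl opt Ev ew pw ne.
have nch : c != h by apply: contraNneq ne => ->.
have nhc : h != c by rewrite eq_sym.
have Ew : cdeg phi w h = cdeg phi w l.
  by apply: (kempe_neighbor (v := v) nhl opt _ ew _).2; rewrite ?Ev ?pw ?eqxx.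
have ncl : c != l by apply: contraNneq ne => ->; rewrite Ew.
have nlc : l != c by rewrite eq_sym.
have nlh : l != h by rewrite eq_sym.
have nvw := e_neq ew.
have nwv : (w == v) = false by rewrite eq_sym; apply: negbTE.
have nyw : y != w by apply: contraNneq nch => yw; rewrite -py yw pw.
have nyw2 : [set v; y] != [set v; w].
  by rewrite eq_set2 eqxx (negPf nyw) (negPf nvw).
have zw z : phi v z \notin [:: h; l; c] -> [set v; z] != [set v; w].
  rewrite !inE !negb_or => /and3P[zh _ _]; rewrite eq_set2 eqxx (negPf nvw) /= orbF.
  by apply: contraNneq zh => ->; rewrite pw.
have [lt|le] := ltnP (cdeg phi w c) (cdeg phi w h).
  (* If [c] is rarer than [h] at [w], giving [v w] the colour [c] suffices. *)
  have [Ra Rb Rd En] := recolor_move nhc S ew pw.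
  set psi := recolor phi v w c in Ra Rb Rd En.
  exists psi; split.
  - by apply: optimal_le opt (recolor_sym _ _ _ S) _; rewrite -/psi; move: En Ev Ec lt; clear; lia.
  - by split; [rewrite Rb Rd // eqxx (negPf nvw) Ec /= -addnA | rewrite /psi recolor_other].
  - move=> u d uv uw; have [Xa Xb] := (Ra u, Rb u).
    rewrite (negPf uv) (negPf uw) !addn0 in Xa Xb.
    case: (d =P h) => [->|/eqP dh] //; case: (d =P c) => [->|/eqP dc] //; exact: Rd.
  - by move=> d; rewrite !inE !negb_or => /and3P[dh _ dc]; apply: Rd.
  - by move=> z zn; rewrite /psi recolor_other // zw.
have gt : cdeg phi w h < cdeg phi w c by rewrite ltn_neqAle eq_sym ne.
(* Otherwise [v w] first gets colour [l] at no cost. This levels the three colours at [v] and makes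
   [c] exceed [h] by at least 2 at [w]. *)
have [R1h R1l R1d En1] := recolor_move nhl S ew pw.
set phi1 := recolor phi v w l in R1h R1l R1d En1.
have opt1 : optimal phi1.
  by apply: optimal_le opt (recolor_sym _ _ _ S) _; rewrite -/phi1; move: En1 Ev Ew; clear; lia.
have Vh1 := R1h v; have Vl1 := R1l v; have Vc1 := R1d v c nch ncl.
have Wh1 := R1h w; have Wl1 := R1l w; have Wc1 := R1d w c nch ncl.
rewrite eqxx (negPf nvw) /= in Vh1 Vl1; rewrite eqxx nwv /= in Wh1 Wl1.
have off1 u d : u != v -> u != w -> cdeg phi1 u d = cdeg phi u d.
  move=> uv uw; have [Xa Xb] := (R1h u, R1l u).
  rewrite (negPf uv) (negPf uw) !addn0 in Xa Xb.
  case: (d =P h) => [->|/eqP dh] //; case: (d =P l) => [->|/eqP dl] //; exact: R1d.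
have pvw1 : phi1 v w = l by rewrite /phi1 /recolor eqxx.
have pvy1 : phi1 v y = c by rewrite /phi1 recolor_other.
have le1 : cdeg phi1 w h + 2 <= cdeg phi1 w c.
  by move: Wh1 Wc1 gt; clear; lia.
have [s [tr lst od Ewc _]] := kempe nch opt1 le1.
have ew' : e w v by rewrite sym_e.
case: (boolP ([set v; y] \in edges w s)) => vys.
  have Evc1 : cdeg phi1 v c = cdeg phi1 v h.
    by move: Vc1 Vh1 Ev Ec; clear; lia.
  (* The cut moves the excess of [c] from [w] to [v] and keeps [v y]; then [v w] returns to colour
     [h]. *)
  have [phi3 [opt3 R3c R3h R3d [pvy3 keep3]]] :=
    kempe_cut nch opt1 tr lst od Ewc Evc1 nvw pvy1 vys.
  have pvw3 : phi3 v w = l by rewrite keep3 pvw1.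
  have [R4l R4h R4d En4] := recolor_move nlh opt3.1 ew pvw3.
  set psi := recolor phi3 v w h in R4l R4h R4d En4.
  have Vc3 := R3c v; have Vh3 := R3h v; have Vl3 := R3d v l nlc nlh.
  have Wc3 := R3c w; have Wh3 := R3h w; have Wl3 := R3d w l nlc nlh.
  rewrite eqxx (negPf nvw) /= in Vc3 Vh3; rewrite eqxx nwv /= in Wc3 Wh3.
  exists psi; split.
  - apply: optimal_le opt3 (recolor_sym _ _ _ opt3.1) _; rewrite -/psi.
    by move: En4 Vh3 Vl3 Vl1 Vh1 Wh3 Wl3 Wl1 Wh1 Ev Ew; clear; lia.
  - split; last by rewrite /psi recolor_other.
    rewrite R4d //.
    have := R4l v; rewrite eqxx (negPf nvw) /=.
    by move: Vc3 Vl3 Vl1 Vc1 Ec; clear; lia.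
  - move=> u d uv uw; rewrite -off1 //.
    have [[Xa Xb] [Ya Yb]] := ((R3c u, R3h u), (R4l u, R4h u)).
    rewrite (negPf uv) (negPf uw) !addn0 in Xa Xb Ya Yb.
    case: (d =P h) => [->|/eqP dh]; first by rewrite Yb.
    case: (d =P l) => [->|/eqP dl]; first by rewrite Ya R3d.
    by rewrite R4d //; case: (d =P c) => [->|/eqP dc] //; rewrite R3d.
  - move=> d; rewrite !inE !negb_or => /and3P[dh dl dc].
    by rewrite R4d // R3d // R1d.
  - move=> z zn; have zvw := zw z zn; rewrite /psi recolor_other //.
    move: zn; rewrite !inE !negb_or => /and3P[dh dl dc].
    by rewrite keep3 /phi1 recolor_other.
(* If the trail avoids [v y], all of it is swapped, which makes [c] rare at [w]; then [v w] takes
   colour [c]. *)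
have [opt2 R2c R2h R2d off2] := kempe_swap nch opt1 tr lst od Ewc.
have keep2 x z : phi1 x z != c -> phi1 x z != h ->
    swap phi1 c h (edges w s) x z = phi1 x z.
  by move=> xc xh; rewrite /swap tpermD ?if_same // eq_sym.
have pvy2 : swap phi1 c h (edges w s) v y = c by rewrite /swap (negPf vys).
set phi2 := swap _ _ _ _ in opt2 R2c R2h R2d off2 keep2 pvy2.
have pvw2 : phi2 v w = l by rewrite keep2 pvw1.
have [R4l R4c R4d En4] := recolor_move nlc opt2.1 ew pvw2.
set psi := recolor phi2 v w c in R4l R4c R4d En4.
have [[Vc2 Vl2] Wl2] := (off2 v c nvw, off2 v l nvw, R2d l nlc nlh).
exists psi; split.
- apply: optimal_le opt2 (recolor_sym _ _ _ opt2.1) _; rewrite -/psi.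
  by move: En4 Vc2 Vl2 Wl2 R2c Vc1 Vl1 Wl1 Wh1 Ec Ew; clear; lia.
- split; last by rewrite /psi recolor_other.
  have := R4l v; have := R4c v; rewrite eqxx (negPf nvw) /=.
  by move: Vc2 Vl2 Vc1 Vl1 Ec; clear; lia.
- move=> u d uv uw; rewrite -off1 //.
  have [Ya Yb] := (R4l u, R4c u).
  rewrite (negPf uv) (negPf uw) !addn0 in Ya Yb.
  case: (d =P c) => [->|/eqP dc]; first by rewrite Yb off2.
  case: (d =P l) => [->|/eqP dl]; first by rewrite Ya off2.
  by rewrite R4d // off2.
- move=> d; rewrite !inE !negb_or => /and3P[dh dl dc].
  by rewrite R4d // off2 // R1d.
- move=> z zn; have zvw := zw z zn; rewrite /psi recolor_other //.
  move: zn; rewrite !inE !negb_or => /and3P[dh dl dc].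
  by rewrite keep2 /phi1 recolor_other.
Qed.

(** The step of a Vizing fan; unequal colour degrees at [x] replace the classical condition that the
    next colour be missing at [x]. *)
Definition fan_step phi v : rel T :=
  fun x y => e v y && (cdeg phi x (phi v y) != cdeg phi x (phi v x)).

Lemma fan_adjacent phi v x s : path (fan_step phi v) x s -> all (e v) s.
Proof. by elim: s x => //= y s IH x /andP[/andP[-> _] /IH]. Qed.

(* One rotation at the first spoke w0 turns a fan for the pair (h, l) into a
   shorter fan, either for (c, l) or, after a Kempe flip, for (c, h), where c is
   the colour of the second spoke; the two conclusions overlap in c. *)
Lemma fan_constant ws phi h l v w0 : optimal phi ->
  cdeg phi v h = cdeg phi v l + 2 -> e v w0 -> phi v w0 = h ->
  path (fan_step phi v) w0 ws -> uniq (l :: map (phi v) (w0 :: ws)) ->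
  forall s, s \in l :: map (phi v) (w0 :: ws) \/ cdeg phi v s = 0 ->
  cdeg phi (last w0 ws) s = cdeg phi (last w0 ws) (phi v (last w0 ws)).
Proof.
elim: ws phi h l w0 => [|w1 ws IH] phi h l w0 opt Ev e0 p0.
  rewrite /= p0 inE andbT => _ nlh s hs.
  have [->|/eqP nsh] := s =P h; first by [].
  have nhs : h != s by rewrite eq_sym.
  (* Both for [s = l] and for [s] absent at [v], the pair [(h, s)] has a gap of at least 2 at
     [v]. *)
  apply/esym; apply: (kempe_neighbor (v := v) nhs opt _ e0 _).2; last first.
    by rewrite p0 eqxx.
  by case: hs => [|->]; [rewrite !inE (negPf nsh) orbF => /eqP-> | ]; rewrite Ev ?leq_addl.
move=> path_ws un; move: (path_ws) => /= /andP[/andP[e1 ne] path1].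
set c := phi v w1 in ne.
rewrite p0 in ne; move: (un); rewrite [map _ _]/= p0 -/c /= !inE !negb_or.
move=> /andP[/and3P[nlh nlc nl] /andP[/andP[nhc nh] /andP[nc un1]]].
have in_ws x : x \in w1 :: ws -> [/\ e v x, x != v & x != w0].
  move=> xin; have ex : e v x.
    by move/allP: (fan_adjacent path_ws); apply.
  split=> //; first by rewrite eq_sym e_neq.
  apply: contraTneq (map_f (phi v) xin) => ->; rewrite p0 /= inE negb_or.
  by rewrite nhc nh.
(* Here [phi'] stands for [phi] or for its flip at [v], in which [h] and [l] exchange roles.
   Rotating it at [w0] gives the induction hypothesis its shorter fan. *)
have claim phi' h' l' : optimal phi' -> perm_eq [:: h'; l'] [:: h; l] ->
    cdeg phi' v h' = cdeg phi' v l' + 2 -> phi' v w0 = h' ->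
    (forall u d, u != v -> cdeg phi' u d = cdeg phi u d) ->
    (forall d, d != h -> d != l -> cdeg phi' v d = cdeg phi v d) ->
    (forall x, phi v x != h -> phi v x != l -> phi' v x = phi v x) ->
    forall s, s \in l' :: map (phi v) (w1 :: ws) \/
      s \notin [:: h; l; c] /\ cdeg phi v s = 0 ->
    cdeg phi (last w1 ws) s = cdeg phi (last w1 ws) (phi v (last w1 ws)).
  move=> opt' perm_hl Ev' p0' off' Vd' keep s hs.
  have memhl d : (d \in [:: h'; l'; c]) = (d \in [:: h; l; c]).
    have := perm_mem perm_hl d; rewrite !inE !orbA => ->; by [].
  have nhl' : h' != l'.
    by have := perm_uniq perm_hl; rewrite /= !inE !andbT => ->; rewrite eq_sym.
  have nl'c : l' != c.
    have := perm_mem perm_hl l'; rewrite !inE eqxx orbT => /esym /orP[] /eqP-> //.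
  have nvw0 : w0 != v by rewrite eq_sym e_neq.
  have p1' : phi' v w1 = c by apply: keep; rewrite eq_sym.
  have ne' : cdeg phi' w0 c != cdeg phi' w0 h'.
    rewrite !off' //; have := perm_mem perm_hl h'; rewrite !inE eqxx => /esym.
    case/orP=> /eqP-> //; have [_ <-] : cdeg phi v h = cdeg phi v l + 2 /\
      cdeg phi w0 h = cdeg phi w0 l by apply: kempe_neighbor; rewrite ?Ev ?p0 ?eqxx // eq_sym.
    by [].
  have [psi [optp [Evp p1p] offp Vdp keepp]] := rotate nhl' opt' Ev' e0 p0' ne' e1 p1'.
  have offpsi u d : u \in w1 :: ws -> cdeg psi u d = cdeg phi u d.
    by move=> /in_ws[_ uv u0]; rewrite offp ?off'.
  have eqpsi : {in w1 :: ws, psi v =1 phi v}.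
    move=> x; rewrite inE => /orP[/eqP->|xws]; first by rewrite p1p.
    have pm := map_f (phi v) xws.
    have xh : phi v x != h by apply: contraNneq nh => <-.
    have xl : phi v x != l by apply: contraNneq nl => <-.
    have xc : phi v x != c by apply: contraNneq nc => <-.
    by rewrite keepp keep // memhl !inE !negb_or xh xl.
  have last_in : last w1 ws \in w1 :: ws by apply: mem_last.
  have mapE : map (psi v) (w1 :: ws) = map (phi v) (w1 :: ws) by apply/eq_in_map.
  have := IH psi c l' w1 optp Evp e1 p1p.
  rewrite mapE offpsi // eqpsi // => /(_ _ _ s) <- //.
  - by rewrite offpsi.
  - have inn : all (mem (w1 :: ws)) (w1 :: ws) by apply/allP.
    apply: (sub_in_path _ inn path1) => x y xin yin /andP[ey nexy].
    by rewrite /fan_step ey !offpsi // !eqpsi.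
  - rewrite /= in un1 *; rewrite -/c nc un1 !andbT inE negb_or nl'c /=.
    have := perm_mem perm_hl l'; rewrite !inE eqxx orbT => /esym /orP[] /eqP-> //.
  case: hs => [|[sn s0]]; [by left | right].
  move: (sn); rewrite !inE !negb_or => /and3P[sh sl sc].
  by rewrite Vdp ?memhl // Vd'.
move=> s hs; rewrite [last _ _]/=.
have nhl : h != l by rewrite eq_sym.
have claim1 := claim phi h l opt (perm_refl _) Ev p0 (fun _ _ _ => erefl)
  (fun _ _ _ => erefl) (fun _ _ _ => erefl).
have [psi [optp [Ph Pl Pd] offp keep flip]] := kempe_flip nhl opt Ev.
(* In the flipped colouring [h] is the low colour, which settles the one colour that [phi] itself
   leaves open. *)
have claim2 : cdeg phi (last w1 ws) h = cdeg phi (last w1 ws) (phi v (last w1 ws)).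
  apply: (claim psi l h) => //; first by rewrite -[[:: h; l]]/(rev [:: l; h]) perm_sym perm_rev.
  - by rewrite Ph Pl.
  - exact: flip.
  - by move=> x xh xl; apply: keep.
  by left; rewrite mem_head.
have [->|/eqP sh] := s =P h; first exact: claim2.
have [sin|snot] := boolP (s \in l :: map (phi v) (w1 :: ws)).
  by apply: claim1; left.
apply: claim1; right; move: snot; rewrite /= !inE !negb_or sh -/c => /and3P[sl sc sm].
rewrite sl sc; split=> //; case: hs => //.
by rewrite /= !inE ?p0 (negPf sl) (negPf sh) (negPf sc) (negPf sm).
Qed.

(** Equal colour degrees at the last end would make [#|C|] divide its degree. A colour of deviating
    degree there is, by [fan_constant], new to the fan and present at [v]. *)
Lemma fan_extend phi h l v w0 ws : optimal phi ->
  cdeg phi v h = cdeg phi v l + 2 -> e v w0 -> phi v w0 = h ->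
  (forall w, 0 < degree e w -> ~~ (#|C| %| degree e w)) ->
  path (fan_step phi v) w0 ws -> uniq (l :: map (phi v) (w0 :: ws)) ->
  exists y, path (fan_step phi v) w0 (rcons ws y) /\
    uniq (l :: map (phi v) (w0 :: rcons ws y)).
Proof.
move=> opt Ev e0 p0 ndiv pa un; set z := last w0 ws.
have const := fan_constant opt Ev e0 p0 pa un; rewrite -/z in const.
have ez : e v z.
  have /allP all_e : all (e v) (w0 :: ws) by rewrite /= e0 (fan_adjacent pa).
  by apply: all_e; apply: mem_last.
have dz : 0 < degree e z.
  by apply/card_gt0P; exists v; rewrite inE sym_e.
have [c cz] : exists c, cdeg phi z c != cdeg phi z (phi v z).
  apply/existsP; apply: contraTT (ndiv z dz); rewrite negb_exists negbK => /forallP E.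
  rewrite -(sum_cdeg phi) (eq_bigr (fun _ => cdeg phi z (phi v z))).
    by rewrite sum_nat_const dvdn_mulr.
  by move=> c _; have := E c; rewrite negbK => /eqP.
have /card_gt0P[y] : 0 < cdeg phi v c.
  by rewrite lt0n; apply: contraNneq cz => E; rewrite const //; right.
rewrite inE => /andP[ey /eqP py]; exists y; split.
  by rewrite rcons_path pa /fan_step ey py -/z cz.
rewrite -rcons_cons map_rcons -rcons_cons rcons_uniq un andbT py.
by apply: contra cz => cin; rewrite const //; left.
Qed.

Lemma optimal_equitable phi :
  (forall w, 0 < degree e w -> ~~ (#|C| %| degree e w)) ->
  optimal phi -> forall v a b, cdeg phi v a <= cdeg phi v b + 1.
Proof.
move=> ndiv opt v h l; rewrite leqNgt; apply/negP => lt.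
have nhl : h != l by apply: contraTneq lt => ->; rewrite -leqNgt leq_addr.
have le : cdeg phi v l + 2 <= cdeg phi v h by rewrite addn2 -addn1.
have [s [_ _ _ Ev _]] := kempe nhl opt le.
have /card_gt0P[w0] : 0 < cdeg phi v h by rewrite Ev addn2.
rewrite inE => /andP[e0 /eqP p0].
(* Extending [#|C|] times would yield [#|C| + 2] distinct colours, counting [l] and the colour of
   the first spoke. *)
have [ws [sz pa un]] : exists ws, [/\ size ws = #|C|,
    path (fan_step phi v) w0 ws & uniq (l :: map (phi v) (w0 :: ws))].
  elim: #|C| => [|n [ws [sz pa un]]].
    by exists [::]; rewrite /= p0 inE eq_sym nhl.
  have [y [pa' un']] := fan_extend opt Ev e0 p0 ndiv pa un.
  by exists (rcons ws y); rewrite size_rcons sz.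
have /= := card_uniqP un; rewrite size_map sz => E.
by have := max_card (mem (l :: map (phi v) (w0 :: ws))); rewrite E ltnNge leqnSn.
Qed.
End EdgeColoring.

(** * Factorizations from equitable colourings *)

Lemma degree_sum (T : finType) (e : rel T) v : degree e v = \sum_w (e v w : nat).
Proof.
rewrite /degree -sum1_card [RHS]big_mkcond /= big_mkcond /=.
by apply: eq_bigr => w _; rewrite inE; case: (e v w).
Qed.

Lemma equitable_coloring (T C : finType) (e : rel T) (c0 : C) :
  simple_graph e -> (forall w, 0 < degree e w -> ~~ (#|C| %| degree e w)) ->
  exists2 phi : T -> T -> C, symcol phi &
    forall v a b, cdeg e phi v a <= cdeg e phi v b + 1.
Proof.
move=> [sym_e irr_e] ndiv.
have [phi opt] : exists phi : T -> T -> C, optimal e phi.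
  exact: (optimal_exists e (phi := fun _ _ => c0) (fun _ _ => erefl)).
by exists phi; [exact: opt.1 | exact: optimal_equitable].
Qed.

(** The vertex [inr x] is a leaf attached to [x] if [P x] holds, and isolated otherwise. *)
Definition pendant (T : finType) (e : rel T) (P : pred T) : rel (T + T) :=
  fun u w => match u, w with
  | inl x, inl y => e x y
  | inl x, inr y | inr x, inl y => (x == y) && P x
  | inr _, inr _ => false
  end.

Lemma pendant_simple (T : finType) (e : rel T) (P : pred T) :
  simple_graph e -> simple_graph (pendant e P).
Proof.
move=> [sym_e irr_e]; split; last by case=> x /=.
by case=> x; case=> y //=; rewrite eq_sym; case: eqP => // ->.
Qed.

Lemma sum_eq_and (T : finType) (x : T) (P : pred T) :
  \sum_y ((x == y) && P y : nat) = P x.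
Proof.
rewrite (bigD1 x) //= eqxx big1 ?addn0 // => y; rewrite eq_sym => /negPf->.
by [].
Qed.

Lemma pendant_degree_inl (T : finType) (e : rel T) (P : pred T) x :
  degree (pendant e P) (inl x) = degree e x + P x.
Proof.
by rewrite !degree_sum big_sumType /= -[in RHS](sum_eq_and x (fun=> P x)).
Qed.

Lemma pendant_degree_inr (T : finType) (e : rel T) (P : pred T) x :
  degree (pendant e P) (inr x) = P x.
Proof.
rewrite !degree_sum big_sumType /= [X in _ + X]big1 // addn0.
exact: (sum_eq_and x (fun=> P x)).
Qed.

Lemma pendant_cdeg (T C : finType) (e : rel T) (P : pred T)
    (phi : T + T -> T + T -> C) x c :
  cdeg (pendant e P) phi (inl x) c =
  cdeg e (fun y z => phi (inl y) (inl z)) x c + (P x && (phi (inl x) (inr x) == c)).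
Proof.
rewrite -[LHS]/(degree (fun u w => pendant e P u w && (phi u w == c)) (inl x)).
rewrite -[cdeg e _ x c]/(degree (fun y z => e y z && (phi (inl y) (inl z) == c)) x).
rewrite !degree_sum big_sumType /=; congr (_ + _).
rewrite -(sum_eq_and x (fun y => P x && (phi (inl x) (inr y) == c))).
by apply: eq_bigr => y _; rewrite andbA.
Qed.

Lemma factorization_of_coloring r a x (T : finType) (e : rel T) (phi : T -> T -> 'I_x) :
  symmetric e -> symcol phi ->
  (forall v i, r <= cdeg e phi v i <= r + a) -> has_factorization r a x e.
Proof.
move=> sym_e S deg; exists (fun i u v => e u v && (phi u v == i)); split.
- move=> i; split; [by move=> u v; rewrite sym_e S | by move=> u v /andP[] |].
  by move=> v; apply: deg.
- by move=> i j u v /andP[_ /eqP<-] /andP[_ /eqP].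
by move=> u v uv; exists (phi u v); rewrite uv eqxx.
Qed.

(** Pendant edges at the vertices of degree divisible by [x] allow an equitable colouring. At a
    vertex of degree [q * x], deleting the leaf leaves colour degrees between [q - 1] and [q + 1],
    and the strict bounds give [r < q < r + a]. *)
Lemma factorization_exists r a x (T : finType) (e : rel T) : 0 < x ->
  simple_graph e -> (forall v, x * r < degree e v < x * (r + a)) ->
  has_factorization r a x e.
Proof.
(* A single colour is treated apart, since 1 divides every degree even after a leaf is added. *)
case: x => // x _ simple_e deg; case: (posnP x) => [x0|x_gt0].
  subst x; apply: (factorization_of_coloring (phi := fun _ _ => ord0)) => [||v i].
  - exact: simple_e.1.
  - by [].
  have -> : cdeg e (fun _ _ => ord0) v i = degree e v.
    apply: eq_card => w; rewrite !inE; case: (e v w) => //=.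
    by apply/eqP; rewrite [i]ord1.
  by have := deg v; rewrite !mul1n => /andP[/ltnW-> /ltnW].
pose P v := x.+1 %| degree e v.
have [|phi S eqt] := equitable_coloring (@ord0 x) (pendant_simple P simple_e).
  rewrite card_ord; case=> v; rewrite ?pendant_degree_inl ?pendant_degree_inr /P.
    case: (boolP (_ %| _)) => [dv|ndv] _ /=; last by rewrite addn0.
    by rewrite dvdn_addr // dvdn1; lia.
  by case: (boolP (_ %| _)) => // _ _; rewrite dvdn1; lia.
apply: (factorization_of_coloring (phi := fun y z => phi (inl y) (inl z))).
- exact: simple_e.1.
- by move=> y z; apply: S.
move=> v i; set psi := fun y z => _.
have psiE j := pendant_cdeg e P phi v j; rewrite -/psi in psiE.
have tot : \sum_(j < x.+1) cdeg (pendant e P) phi (inl v) j = degree e v + P v.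
  by rewrite sum_cdeg pendant_degree_inl.
(* A colour degree of at most [m] keeps the others at most [m + 1], which bounds the total; [dn] is
   the reverse estimate. *)
have up j m : cdeg (pendant e P) phi (inl v) j <= m -> degree e v + P v <= m + x * m.+1.
  move=> le; rewrite -tot (bigD1 j) //=; apply: leq_add => //.
  apply: (@leq_trans (\sum_(k < x.+1 | k != j) m.+1)).
    by apply: leq_sum => k _; apply: leq_trans (eqt _ _ j) _; rewrite addn1.
  by rewrite sum_nat_const cardC1 card_ord.
have dn j m : m < cdeg (pendant e P) phi (inl v) j -> m.+1 + x * m <= degree e v + P v.
  move=> lt; rewrite -tot (bigD1 j) //=; apply: leq_add => //.
  apply: (@leq_trans (\sum_(k < x.+1 | k != j) m)).
    by rewrite sum_nat_const cardC1 card_ord.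
  by apply: leq_sum => k _; have := eqt (inl v) j k; lia.
have /andP[d1 d2] := deg v.
have := psiE i; case: (boolP (P v)) => [dv|ndv].
  rewrite dv addn1 in up dn; have /dvdnP[q Eq] := dv; rewrite {}Eq in d1 d2 up dn.
  have lq : q <= cdeg (pendant e P) phi (inl v) i.
    by rewrite leqNgt; apply/negP => lt; have := up i q.-1; case: q lt {d1 d2 up dn dv} => // q; lia.
  have gq : cdeg (pendant e P) phi (inl v) i <= q.+1.
    by rewrite leqNgt; apply/negP => lt; have := dn i q.+1 lt; nia.
  have [rq qa] : r < q /\ q < r + a by split; nia.
  by case: (phi _ _ == i) => /=; lia.
rewrite (negPf ndv) addn0 in up dn * => E; rewrite addn0 in E; rewrite -E.
apply/andP; split; rewrite leqNgt; apply/negP => lt.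
  by have := up i r.-1; case: r lt d1 {d2 deg up dn} => // r; nia.
by have := dn i (r + a) lt; nia.
Qed.

(** * Graphs without factorizations *)

Lemma odd_sum_odd (I : eqType) (s : seq I) (g : I -> nat) :
  {in s, forall i, odd (g i)} -> odd (\sum_(i <- s) g i) = odd (size s).
Proof.
elim: s => [|i s IH] H; first by rewrite big_nil.
by rewrite big_cons oddD H ?mem_head //= IH // => j js; rewrite H // inE js orbT.
Qed.

Lemma even_double_sum (T : finType) (f : rel T) (s : seq T) :
  symmetric f -> irreflexive f -> ~~ odd (\sum_(u <- s) \sum_(w <- s) f u w).
Proof.
move=> sym_f irr_f; elim: s => [|x s IH]; first by rewrite big_nil.
rewrite big_cons big_cons irr_f add0n.
under [X in odd (_ + X)]eq_bigr do rewrite big_cons sym_f.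
by rewrite big_split addnA oddD (negPf IH) addnn odd_double.
Qed.

(** The degrees on [W] sum to twice the number of edges inside, and each of them is odd. *)
Lemma handshake (T : finType) (f : rel T) (W : {set T}) :
  symmetric f -> irreflexive f -> {in W, forall u, odd (degree f u)} ->
  (forall u w, u \in W -> w \notin W -> ~~ f u w) -> ~~ odd #|W|.
Proof.
move=> sym_f irr_f odd_deg no_exit; rewrite cardE -(@odd_sum_odd _ _ (degree f)).
  rewrite -[X in odd X](_ : \sum_(u <- enum W) \sum_(w <- enum W) f u w = _).
    exact: even_double_sum.
  rewrite !big_enum /=; apply: eq_bigr => u uW; rewrite degree_sum big_enum /=.
  rewrite [RHS](bigID (mem W)) /= [X in _ = _ + X]big1 ?addn0 // => w wW.
  by rewrite (negPf (no_exit u w uW wW)).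
by move=> u; rewrite mem_enum; apply: odd_deg.
Qed.

Lemma factorization_degree x (T : finType) (e : rel T) (F : 'I_x -> rel T) v :
  (forall i, subrel (F i) e) ->
  (forall i j u w, F i u w -> F j u w -> i = j) ->
  (forall u w, e u w -> exists i, F i u w) ->
  degree e v = \sum_(i < x) degree (F i) v.
Proof.
move=> sub disj cov; rewrite degree_sum.
under [RHS]eq_bigr do rewrite degree_sum.
rewrite exchange_big; apply: eq_bigr => w _; case: (boolP (e v w)) => [ew|new].
  have [i Fi] := cov _ _ ew; rewrite (bigD1 i) //= Fi big1 // => j ji.
  by apply/eqP; rewrite eqb0; apply: contra ji => Fj; apply/eqP; apply: disj Fj Fi.
by rewrite big1 // => i _; apply/eqP; rewrite eqb0; apply: contra new; apply: sub.
Qed.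

Lemma factorization_bounds r a x (T : finType) (e : rel T) v :
  has_factorization r a x e -> x * r <= degree e v <= x * (r + a).
Proof.
case=> F [fac disj cov]; rewrite (factorization_degree v _ disj cov); last first.
  by move=> i; case: (fac i).
have const n : x * n = \sum_(i < x) n by rewrite sum_nat_const card_ord.
rewrite !const; apply/andP; split; apply: leq_sum => i _.
  by have [_ _ /(_ v)/andP[]] := fac i.
by have [_ _ /(_ v)/andP[]] := fac i.
Qed.

(* All factors are r-regular on W, and one of them avoids the only edge leaving
   W, which contradicts the handshake lemma. *)
Lemma no_regular_factorization r a x (T : finType) (e : rel T) (W : {set T}) p q :
  odd r -> 2 <= x -> simple_graph e -> odd #|W| ->
  {in W, forall u, degree e u = x * r} ->
  (forall u w, u \in W -> w \notin W -> e u w -> u = p /\ w = q) ->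
  ~ has_factorization r a x e.
Proof.
move=> odd_r x2 [sym_e irr_e] oddW degW exit [F [fac disj cov]].
have sub i : subrel (F i) e by case: (fac i).
have degF i u : u \in W -> degree (F i) u = r.
  move=> uW; have := degW u uW; rewrite (factorization_degree u sub disj cov).
  have lo j : r <= degree (F j) u by have [_ _ /(_ u)/andP[]] := fac j.
  have -> : x * r = \sum_(j < x) r by rewrite sum_nat_const card_ord.
  move=> E; apply/eqP; rewrite eqn_leq lo andbT.
  rewrite leqNgt; apply/negP => lt.
  suff : \sum_(j < x) r < \sum_(j < x) degree (F j) u by rewrite E ltnn.
  by rewrite (bigD1 i) //= [X in _ < X](bigD1 i) //= -addSn leq_add // leq_sum.
(* At most one of two distinct factors contains the edge from [p] to [q]. *)
have [i Fi] : exists i, ~~ F i p q.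
  pose i0 := Ordinal (ltnW x2); pose i1 := Ordinal x2.
  case: (boolP (F i0 p q)) => [F0|]; last by exists i0.
  by exists i1; apply/negP => /(disj _ _ _ _ F0).
have [sym_f _ _] := fac i.
have := oddW; apply/negP; apply: (handshake sym_f).
- by move=> u; apply/negbTE/negP => /sub; rewrite irr_e.
- by move=> u uW; rewrite degF.
move=> u w uW wW; apply/negP => Fuw; have [Eu Ew] := exit u w uW wW (sub _ _ _ Fuw).
by rewrite -Eu -Ew Fuw in Fi.
Qed.

(** * The extremal graphs *)

Definition complete n : rel 'I_n := fun i j => i != j.

Lemma complete_simple n : simple_graph (@complete n).
Proof. by split=> [i j|i]; rewrite /complete 1?eq_sym // eqxx. Qed.

Lemma complete_degree n i : degree (@complete n) i = n.-1.
Proof.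
rewrite -[n in RHS]card_ord -(cardsC1 i); apply: eq_card => j.
by rewrite !inE /complete eq_sym.
Qed.

Definition disjoint_union (S T : finType) (e : rel S) (f : rel T) : rel (S + T) :=
  fun u w => match u, w with
  | inl x, inl y => e x y
  | inr x, inr y => f x y
  | _, _ => false
  end.

Lemma disjoint_union_simple (S T : finType) (e : rel S) (f : rel T) :
  simple_graph e -> simple_graph f -> simple_graph (disjoint_union e f).
Proof.
by move=> [se ie] [sf i_f]; split=> [[x|x] [y|y]|[x|x]] //=.
Qed.

Lemma disjoint_union_degree_inl (S T : finType) (e : rel S) (f : rel T) x :
  degree (disjoint_union e f) (inl x) = degree e x.
Proof. by rewrite !degree_sum big_sumType /= [X in _ + X]big1 ?addn0. Qed.

Lemma disjoint_union_degree_inr (S T : finType) (e : rel S) (f : rel T) x :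
  degree (disjoint_union e f) (inr x) = degree f x.
Proof. by rewrite !degree_sum big_sumType /= big1. Qed.

(* The complement of a path on three vertices with centre [None] together with
   m disjoint edges: all degrees are 2m + 1, except that of [None], which is 2m. *)
Definition half_gadget m : rel (option (option 'I_m * bool)) :=
  fun u w => match u, w with
  | None, None => false
  | None, Some (i, _) | Some (i, _), None => isSome i
  | Some (i, b), Some (j, c) => (i != j) || ~~ isSome i && (b != c)
  end.

Lemma half_gadget_simple m : simple_graph (@half_gadget m).
Proof.
split=> [[[i b]|] [[j c]|]|[[i b]|]] //=; last by rewrite !eqxx andbF.
by rewrite eq_sym [c == b]eq_sym; case: (j =P i) => [->|].
Qed.

Lemma half_gadget_degree m u :
  degree (@half_gadget m) u = m.*2 + (u != None).
Proof.
have card_all : #|{: option (option 'I_m * bool)}| = m.*2.+3.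
  by rewrite card_option card_prod card_option card_bool card_ord muln2.
(* Degrees are found by counting non-neighbours, the vertex itself included. *)
have main (A : {set option (option 'I_m * bool)}) n : #|A| = n ->
    (forall w, half_gadget u w = (w \notin A)) -> degree (@half_gadget m) u = m.*2.+3 - n.
  move=> cA E; rewrite -card_all -cA -(cardsC A) addKn; apply: eq_card => w.
  by rewrite !inE E.
case: u main => [[[i|] b]|] main.
- have c2 : #|[set Some (Some i, true); Some (Some i, false)]| = 2.
    by rewrite cards2 (inj_eq Some_inj) xpair_eqE andbF.
  rewrite (main _ _ c2) ?addn1 // => -[[[j|] c]|]; rewrite !inE //=.
  rewrite !(inj_eq Some_inj) !xpair_eqE !(inj_eq Some_inj) orbF eq_sym.
  by case: (j == i); case: c.
- have c2 : #|[set None; Some (@None 'I_m, b)]| = 2 by rewrite cards2.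
  rewrite (main _ _ c2) ?addn1 // => -[[[j|] c]|]; rewrite !inE //=.
  by rewrite (inj_eq Some_inj) xpair_eqE eqxx eq_sym.
have c3 : #|None |: [set Some (@None 'I_m, true); Some (None, false)]| = 3.
  by rewrite cardsU1 cards2 !inE.
rewrite (main _ _ c3) ?addn0 ?subSS ?subn0 // => -[[[j|] c]|]; rewrite !inE //=.
by rewrite !(inj_eq Some_inj) !xpair_eqE !eqxx; case: c.
Qed.

(** Two copies of the gadget, each of odd order [2m + 3]; the edge joining the two deficient
    vertices makes the graph regular. *)
Definition bridged m : rel (option (option 'I_m * bool) * bool) :=
  fun u w => if u.2 == w.2 then half_gadget u.1 w.1
             else (u.1 == None) && (w.1 == None).

Lemma bridged_simple m : simple_graph (@bridged m).
Proof.
have [sym_g irr_g] := half_gadget_simple m.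
split=> [u w|u]; last by rewrite /bridged eqxx irr_g.
by rewrite /bridged eq_sym sym_g andbC.
Qed.

Lemma bridged_degree m u : degree (@bridged m) u = m.*2.+1.
Proof.
case: u => u b; rewrite degree_sum.
rewrite -(pair_bigA _ (fun w c => bridged (u, b) (w, c) : nat)) /=.
have -> : \sum_w \sum_c (bridged (u, b) (w, c) : nat) =
    \sum_w ((half_gadget u w : nat) + ((w == None) && (u == None))).
  apply: eq_bigr => w _; rewrite /= big_bool /bridged /= [(w == _) && _]andbC.
  by case: b => //=; rewrite addnC.
rewrite big_split /= -degree_sum half_gadget_degree (bigD1 None) //=.
rewrite [X in _ + (_ + X)]big1 => [|w /negPf-> //].
by case: u => [u|]; rewrite /= !addn0 addn1.
Qed.

Lemma regular_graph_with_odd_side d : exists (T : finType) (e : rel T) (W : {set T}) p q,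
  [/\ simple_graph e, forall v, degree e v = d, odd #|W|
    & forall u w, u \in W -> w \notin W -> e u w -> u = p /\ w = q].
Proof.
case: (boolP (odd d)) => od.
  exists _, (@bridged d./2), [set u | u.2], (None, true), (None, false); split.
  - exact: bridged_simple.
  - by move=> v; rewrite bridged_degree -[RHS]odd_double_half od.
  - rewrite (_ : [set u | u.2] = setX setT [set true]).
      rewrite cardsX cards1 cardsT muln1 card_option card_prod card_option card_bool.
      by rewrite muln2 /= odd_double.
    by apply/setP => -[u b]; rewrite !inE /=; case: b.
  case=> [u b] [w c]; rewrite !inE /bridged /= => -> /negPf->.
  by case/andP=> /eqP-> /eqP->.
(* For even [d] the whole complete graph has odd order; no edge leaves it, so [p] and [q] are
   arbitrary. *)
exists _, (@complete d.+1), setT, ord0, ord0; split.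
- exact: complete_simple.
- by move=> v; rewrite complete_degree.
- by rewrite cardsT card_ord /= od.
by move=> u w _; rewrite inE.
Qed.

(** The regular component obstructs [k] factors; a complete component attains the maximum degree,
    which bounds the number of factors from below. *)
Lemma bad_graph r s k : odd r -> 2 <= k -> exists (T : finType) (e : rel T),
  [/\ simple_graph e, degrees_between (k * r) (k * r + s) e,
      exists v, degree e v = k * r, exists v, degree e v = k * r + s
    & forall a, ~ has_factorization r a k e].
Proof.
move=> odd_r k2; have [B [e [W [p [q [simple_e deg oddW exit]]]]]] :=
  regular_graph_with_odd_side (k * r).
pose K := @complete (k * r + s).+1.
have simple_u : simple_graph (disjoint_union K e).
  exact: disjoint_union_simple (complete_simple _) simple_e.
exists _, (disjoint_union K e); split=> //.
- case=> v; rewrite ?disjoint_union_degree_inl ?disjoint_union_degree_inr ?deg.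
    by rewrite complete_degree leq_addr leqnn.
  by rewrite leqnn leq_addr.
- by exists (inr p); rewrite disjoint_union_degree_inr.
- by exists (inl ord0); rewrite disjoint_union_degree_inl complete_degree.
move=> a; apply: (@no_regular_factorization _ _ _ _ _ (inr @: W) (inr p) (inr q)) => //.
- by rewrite card_imset //; apply: inr_inj.
- by move=> _ /imsetP[u _ ->]; rewrite disjoint_union_degree_inr.
move=> _ w /imsetP[u uW ->]; case: w => // w; rewrite mem_imset; last exact: inr_inj.
by move=> wW /= /(exit _ _ uW wW)[-> ->].
Qed.

(** * Arithmetic of the threshold *)

(** The witnesses are the [t] largest integers below [d / r]. The smallest is still at least [q],
    and [d] exceeds [r] times it by at most [t * r]. *)
Lemma window r s a t q d : 0 < r -> 0 < t -> t * r + s <= q * a ->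
  r * q + (t - 1) * r + 1 <= d -> exists xs : seq nat,
  [/\ uniq xs, size xs = t & forall x, x \in xs -> d + s <= x * (r + a) /\ x * r < d].
Proof.
move=> r0 t0 hq hd; pose m := d.-1 %/ r.
have Ed := divn_eq d.-1 r; have ltr := ltn_pmod d.-1 r0.
rewrite -/m in Ed; set o := _ %% r in Ed ltr.
have mq : q + (t - 1) <= m by rewrite leq_divRL // mulnDl; lia.
exists [seq m - i | i <- iota 0 t]; split; rewrite ?size_map ?size_iota //.
  rewrite map_inj_in_uniq ?iota_uniq // => i j; rewrite !mem_iota => hi hj; lia.
move=> x /mapP[i]; rewrite mem_iota => hi ->.
have hx : q <= m - i by lia.
have hx2 : m <= m - i + (t - 1) by lia.
set x' := m - i in hx hx2 *.
have x'm : x' <= m by rewrite leq_subr.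
have d0 : 0 < d by lia.
split; last by nia.
have h1 : q * a <= x' * a by rewrite leq_mul2r hx orbT.
have h2 : m * r <= x' * r + (t - 1) * r by rewrite -mulnDl leq_mul2r hx2 orbT.
rewrite mulnBl mul1n in h2; rewrite mulnDr.
have : r <= t * r by rewrite leq_pmull.
lia.
Qed.

Definition ceil_div n a := (n + a.-1) %/ a.

Lemma ceil_div_bounds n a : 0 < a -> n <= ceil_div n a * a < n + a.
Proof.
move=> a0; rewrite /ceil_div; have := divn_eq (n + a.-1) a.
have := ltn_pmod (n + a.-1) a0; lia.
Qed.

Lemma ceil_ratio n a : 0 < a ->
  (Num.ceil (n%:R / a%:R : rat) = (ceil_div n a)%:Z)%R.
Proof.
move=> a0; have /andP[h1 h2] := ceil_div_bounds n a0; set q := ceil_div n a in h1 h2 *.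
have ar : (0 < a%:R :> rat)%R by rewrite ltr0n.
apply: ceil_def; rewrite rmorphB /= -!pmulrn ler_pdivrMr // ltr_pdivlMr //.
rewrite -natrM ler_nat h1 andbT mulrBl mul1r -natrM ltrBlDr -natrD ltr_nat.
exact: h2.
Qed.

(** Using [s + 1] in [window] supplies the strict upper bound that [factorization_exists]
    requires. *)
Lemma sigma_upper r s a t q : 0 < r -> 0 < t -> t * r + s.+1 <= q * a ->
  sigma_property r s a t (r * q + (t - 1) * r + 1)%:Z.
Proof.
move=> r0 t0 hq d; rewrite lez_nat => hd T e simple_e deg.
have [xs [un sz H]] := window r0 t0 hq hd.
exists xs; split=> //; first by rewrite sz.
move=> x /H[h1 h2]; have x0 : 0 < x by case: x h1 {h2} => //; lia.
apply: factorization_exists => // v; have /andP[l1 l2] := deg v.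
by rewrite (leq_trans h2 l1) /=; apply: leq_ltn_trans l2 _; rewrite -addnS.
Qed.

(** On the bad graph the extreme degrees force [q <= x <= k] and [x = k] is impossible, which leaves
    only [t - 1] values. *)
Lemma sigma_lower r s a t q (M : int) : odd r -> 0 < t -> 2 <= q + (t - 1) ->
  q * a < t * r + s + a -> sigma_property r s a t M ->
  ((r * q + (t - 1) * r + 1)%:Z <= M)%R.
Proof.
move=> odd_r t0 k2 hq prop; rewrite leNgt; apply/negP => lt.
set k := q + (t - 1) in k2.
have [T [e [simple_e deg [v1 E1] [v2 E2] bad]]] := bad_graph s odd_r k2.
have Mk : (M <= (k * r)%:Z)%R by rewrite /k mulnDl mulnC; lia.
have [xs [un sz H]] := prop _ Mk T e simple_e deg.
have r0 : 0 < r by case: r odd_r {hq prop lt bad deg E1 E2 Mk H}.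
have sub : {subset xs <= iota q (t - 1)}.
  move=> x xin; have fx := H x xin; rewrite mem_iota -/k.
  have /andP[_ b2] := factorization_bounds v2 fx; rewrite E2 in b2.
  have /andP[b1 _] := factorization_bounds v1 fx; rewrite E1 leq_mul2r in b1.
  have nk : x != k by apply/eqP => xk; rewrite xk in fx; apply: bad fx.
  have lx : x < k by move: b1; rewrite ltn_neqAle nk /=; case/orP => // /eqP r00; rewrite r00 in r0.
  (* If [x < q], then [x * a < t * r + s], so even the largest factor degrees cannot sum to
     [k * r + s]. *)
  rewrite lx andbT leqNgt; apply/negP => lt2.
  have h1 : x.+1 * (r + a) <= q * (r + a) by rewrite leq_mul2r lt2 orbT.
  move: b2 h1 hq; rewrite /k mulSn !mulnDl !mulnDr mulnBl mul1n.
  have : r <= t * r by rewrite leq_pmull.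
  by clear; lia.
have := uniq_leq_size un sub; rewrite size_iota => /(leq_trans sz).
by rewrite leqNgt subn1 ltn_predL t0.
Qed.

(** Descent from [up] must stop because [lo] bounds [P] from below; this gives the existence of
    sigma. *)
Lemma least_integer (P : int -> Prop) (lo up : int) :
  (forall M, P M -> (lo <= M)%R) -> P up ->
  exists sigma, P sigma /\ forall M, P M -> (sigma <= M)%R.
Proof.
move=> bound Pup; have [n] := ubnP `|(up - lo)%R|%N.
elim: n up Pup => // n IH up Pup lt.
case: (classic (exists2 M, P M & (M < up)%R)) => [[M PM ltM]|no].
  by apply: (IH M) => //; have := bound _ PM; lia.
exists up; split=> // M PM; rewrite leNgt; apply/negP => ltM.
by apply: no; exists M.
Qed.

Local Open Scope ring_scope.

Theorem theorem28 (r s a t : nat)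
  (hr : (1 <= r)%N) (hrodd : odd r) (ha : (1 <= a)%N) (haodd : odd a)
  (ht : (2 <= t)%N \/ (t = 1%N /\ (a < r * t + s)%N)) :
  (exists sigma : int,
     [/\ is_sigma r s a t sigma,
         r%:Z * Num.ceil ((t * r + s)%:R / a%:R : rat)
           + (t%:Z - 1) * r%:Z + 1 <= sigma
       & sigma <= r%:Z * Num.ceil ((t * r + s + 1)%:R / a%:R : rat)
           + (t%:Z - 1) * r%:Z + 1]) /\
  (forall d : nat,
     r%:Z * Num.ceil ((r * t + s)%:R / a%:R : rat)
       + (t%:Z - 1) * r%:Z + 1 <= d%:Z ->
     at_least t (fun x : int =>
       (d + s)%:R / (r + a)%:R <= x%:~R :> rat /\ x%:~R < d%:R / r%:R :> rat)).
Proof.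
have t0 : (0 < t)%N by case: ht => [/ltnW | [->]].
have int_bound q : r%:Z * q%:Z + (t%:Z - 1) * r%:Z + 1 = (r * q + (t - 1) * r + 1)%:Z.
  by rewrite -[t in LHS](subnK t0) !PoszD !PoszM addrK.
rewrite [(r * t)%N]mulnC !ceil_ratio // !int_bound.
have /andP[q1_ge q1_lt] := ceil_div_bounds (t * r + s) ha.
have /andP[q2_ge _] := ceil_div_bounds (t * r + s + 1) ha.
set q1 := ceil_div (t * r + s) a in q1_ge q1_lt *.
set q2 := ceil_div _ a in q2_ge *.
split.
  (* The obstruction needs two factors. For [t = 1] the assumption [a < r * t + s] yields [q1 >= 2];
     for larger [t], [q1 >= 1] is enough. *)
  have k2 : (2 <= q1 + (t - 1))%N.
    have q1_gt0 : (0 < q1)%N.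
      rewrite lt0n; apply: contraTneq q1_ge => ->.
      by rewrite mul0n -ltnNge ltn_addr // muln_gt0 t0.
    case: ht => [|[t1 lt_a]]; first lia.
    rewrite t1 addn0 ltnNge; apply: contraTN q1_ge => q1_le.
    rewrite -ltnNge [(t * r)%N]mulnC; apply: leq_ltn_trans lt_a.
    by rewrite -[leqRHS]mul1n leq_mul2r q1_le orbT.
  have lower M := @sigma_lower r s a t q1 M hrodd t0 k2 q1_lt.
  have upper : sigma_property r s a t (r * q2 + (t - 1) * r + 1)%:Z.
    by apply: sigma_upper; rewrite // -addn1 addnA.
  have [sigma [prop least]] := least_integer lower upper.
  by exists sigma; split=> //; [exact: lower | exact: least].
move=> d; rewrite lez_nat => hd.
have [xs [un sz H]] := window hr t0 q1_ge hd.
exists [seq x%:Z | x <- xs]; rewrite map_inj_uniq ?size_map ?sz => [|x y []//].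
split=> // _ /mapP[x /H[h1 h2] ->]; rewrite -pmulrn.
rewrite ler_pdivrMr ?ltr_pdivlMr ?ltr0n ?addn_gt0 ?hr //.
by rewrite -!natrM ler_nat ltr_nat.
Qed.
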